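(* Let $\alpha_1,\alpha_0>0$, let $\mathbf{X}=\{X_n:n\ge1\}$ be the Pólya sequence with values in $\{0,1\}$ and parameter $\alpha_1\delta_1+\alpha_0\delta_0$, and let $\eta$ be the a.s. limit of $\frac1n\sum_{i=1}^nX_i$ (a Beta random variable with parameters $(\alpha_1,\alpha_0)$). For every $n\ge0$, $Y\in\mathcal{M}_n(\eta)$ if and only if $Y$ is a (real constant) multiple of $J_n^{\alpha_1,\alpha_0}(\eta)$, where $J_n^{\alpha_1,\alpha_0}$ is the modified Jacobi polynomial.
   Context: The Pólya sequence on $\{0,1\}$ with parameter $\alpha=\alpha_1\delta_1+\alpha_0\delta_0$ is the sequence of $\{0,1\}$-valued random variables with $\mathbb{P}(X_1=a_1,\ldots,X_k=a_k)=\prod_{i=1}^k\frac{\alpha(\{a_i\})+\sum_{l=1}^{i-1}\mathbf{1}(a_l=a_i)}{\alpha_1+\alpha_0+i-1}$. The associated Dirichlet–Ferguson process is $D(\{1\})=\eta=1-D(\{0\})$; conditionally on $\eta$ the $X_i$ are i.i.d. Bernoulli($\eta$). Write $\mathbf{X}_n=(X_1,\ldots,X_n)$. $L^2(\eta)$ is the space of square-integrable functionals of $\eta$. $\Xi_n(\mathbf{X})$, $n\geq 1$, is the class of symmetric functions $\phi$ on $\{0,1\}^n$ with $\mathbb{E}(\phi(\mathbf{X}_n)\mid\mathbf{X}_{n-1})=0$ a.s. (for $n=1$: $\mathbb{E}(\phi(X_1))=0$). Let $\mathbf{1}^m\mathbf{0}^{n-m}$ denote the vector with $m$ ones followed by $n-m$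 zeros. $\mathcal{M}_0(\eta)=\mathbb{R}$ and, for $n\ge1$, $$\mathcal{M}_n(\eta)=\Bigl\{Y\in L^2(\eta):Y=\sum_{m=0}^n\binom nm\phi(\mathbf{1}^m\mathbf{0}^{n-m})\eta^m(1-\eta)^{n-m},\ \phi\in\Xi_n(\mathbf{X})\Bigr\}.$$ Modified Jacobi polynomials: for $n\ge0$, $J_n^{\alpha_1,\alpha_0}(x)=\sqrt{k_n(\alpha_1,\alpha_0)}\sum_{a=0}^ng_{n,a}(\alpha_1+\alpha_0-1,\alpha_1)x^a$, where $$g_{n,a}(p,q)=\binom na(-1)^{n-a}\frac{\Gamma(q+n)\Gamma(p+a+n)}{\Gamma(p+2n)\Gamma(a+q)},$$ $$k_n(\alpha_1,\alpha_0)=\frac{(2n+\alpha_1+\alpha_0-1)\Gamma^2(2n+\alpha_0+\alpha_1-1)}{n!\,\Gamma(n+\alpha_1)\Gamma(n+\alpha_0)\Gamma(n+\alpha_1+\alpha_0-1)}B(\alpha_1,\alpha_0),$$ and $B$ is the Beta function; for $n=0$ these expressions are read as $J_0^{\alpha_1,\alpha_0}=1$. *)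

(* Defs.v *)
From HB Require Import structures.
From mathcomp Require Import all_boot all_order all_algebra all_fingroup.
From mathcomp Require Import all_classical all_reals all_analysis.

Set Implicit Arguments.
Unset Strict Implicit.
Unset Printing Implicit Defensive.

Import Order.TTheory GRing.Theory Num.Theory.
Import numFieldNormedType.Exports.

Local Open Scope classical_set_scope.
Local Open Scope ring_scope.

Section special_functions.
Context {R : realType}.
Implicit Types z a b p q : R.

(* [Rintegral] is total: these are the usual Gamma and Beta functions on
   positive arguments only, the only ones at which they are used. *)
Definition Gamma z : R :=
  \int[@lebesgue_measure R]_(t in `]0, +oo[) (t `^ (z - 1) * expR (- t)).

Definition Beta a b : R :=
  \int[@lebesgue_measure R]_(t in `]0, 1[)
    (t `^ (a - 1) * (1 - t) `^ (b - 1)).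

Definition jacobi_coef p q (n a : nat) : R :=
  'C(n, a)%:R * (- 1) ^+ (n - a) *
  ((Gamma (q + n%:R) * Gamma (p + a%:R + n%:R)) /
   (Gamma (p + 2 * n%:R) * Gamma (a%:R + q))).

Definition jacobi_norm (al1 al0 : R) (n : nat) : R :=
  ((2 * n%:R + al1 + al0 - 1) * Gamma (2 * n%:R + al0 + al1 - 1) ^+ 2) /
  (n`!%:R * Gamma (n%:R + al1) * Gamma (n%:R + al0) *
   Gamma (n%:R + al1 + al0 - 1)) * Beta al1 al0.

(* The case n = 0 is separate because Gamma (al1 + al0 - 1) may be evaluated
   at a nonpositive argument there. *)
Definition modified_jacobi (al1 al0 : R) (n : nat) : {poly R} :=
  if n == 0%N then 1 else
  Num.sqrt (jacobi_norm al1 al0 n) *: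
    \poly_(a < n.+1) jacobi_coef (al1 + al0 - 1) al1 n a.

End special_functions.

Section polya.
Context {d : measure_display} {T : measurableType d} {R : realType}.
Variable P : probability T R.

(* Random sequences are indexed from 0: [X i] is the (i+1)-th variable. *)
Implicit Types (X : nat -> {RV P >-> bool}) (eta Y : {RV P >-> R}).

(* Mass of the atom [b] under al1 * delta_1 + al0 * delta_0. *)
Definition polya_atom (al1 al0 : R) (b : bool) : R := if b then al1 else al0.

Definition polya_sequence (al1 al0 : R) X : Prop :=
  forall (k : nat) (a : k.-tuple bool),
    P [set w | forall i : 'I_k, X i w = tnth a i] =
    (\prod_(i < k)
       ((polya_atom al1 al0 (tnth a i)
         + \sum_(l < k | (l < i)%N) (tnth a l == tnth a i)%:R)
        / (al1 + al0 + i%:R)))%:E.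

Definition prefix_vector X (n : nat) (w : T) : n.-tuple bool :=
  [tuple X i w | i < n].

(* The sigma-algebra generated by the first n variables; it is the trivial one
   for n = 0. *)
Definition prefix_sigma_algebra X (n : nat) : set (set T) :=
  g_sigma_preimage (fun i : 'I_n => X i : T -> bool).

(* [W] is a version of the conditional expectation of [Z] given the
   sub-sigma-algebra [G]. *)
Definition is_cond_expectation (G : set (set T)) (Z W : T -> R) : Prop :=
  [/\ P.-integrable setT (EFin \o Z),
      P.-integrable setT (EFin \o W),
      (forall B : set R, measurable B -> G (W @^-1` B)) &
      forall A, G A ->
        (\int[P]_(w in A) (W w)%:E = \int[P]_(w in A) (Z w)%:E)%E].

Definition symmetric_fun (n : nat) (phi : n.-tuple bool -> R) : Prop :=
  forall (s : 'S_n) (a : n.-tuple bool),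
    phi [tuple tnth a (s i) | i < n] = phi a.

(* Used for 1 <= n; for n = 1 the condition is that phi (X_1) has mean 0. *)
Definition Xi X (n : nat) (phi : n.-tuple bool -> R) : Prop :=
  symmetric_fun phi /\
  is_cond_expectation (prefix_sigma_algebra X n.-1)
    (fun w => phi (prefix_vector X n w)) (cst 0).

Definition ones_zeros (n m : nat) : n.-tuple bool := [tuple (i < m)%N | i < n].

(* Elements of L^2 are represented by random variables, up to P-a.s.
   equality. *)
Definition L2_functional eta Y : Prop :=
  (Y : T -> R) \in Lfun P 2%:E /\
  exists h : {mfun R >-> R}, {ae P, forall w, Y w = h (eta w)}.

Definition chaos X eta (n : nat) Y : Prop :=
  if n == 0%N then exists c : R, {ae P, forall w, Y w = c}
  else L2_functional eta Y /\
    exists2 phi : n.-tuple bool -> R, Xi X phi &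
      {ae P, forall w, Y w =
         \sum_(m < n.+1) 'C(n, m)%:R * phi (ones_zeros n m)
                         * eta w ^+ m * (1 - eta w) ^+ (n - m)}.

End polya.

(* Main.v *)
Require Import Defs.
From mathcomp Require Import all_boot all_order all_algebra all_fingroup.
From mathcomp Require Import all_classical all_reals all_analysis.
From mathcomp Require Import measurable_realfun ess_sup_inf.
From mathcomp Require Import ring lra zify.
Import Order.TTheory GRing.Theory Num.Theory.
Import numFieldNormedType.Exports.

Set Implicit Arguments.
Unset Strict Implicit.
Unset Printing Implicit Defensive.

Local Open Scope classical_set_scope.
Local Open Scope ring_scope.

(* A symmetric phi depends only on the number m of ones, say through f(m).
   Integrating phi(X_1, ..., X_n) over the cylinders of X_1, ..., X_(n-1), which
   all have positive probability, turns the centering condition into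
     f(m + 1) (al1 + m) + f(m) (al0 + n - 1 - m) = 0   for 0 <= m < n,
   so f is f(0) times the alternating product of (al0 + n - 1 - j) / (al1 + j).
   Expanding sum_m C(n, m) f(m) x^m (1 - x)^(n - m) in powers of x, the
   Chu-Vandermonde identity gives the coefficient
     f(0) C(n, a) (-1)^a prod_(j < a) (al1 + al0 + n - 1 + j) / (al1 + j)
   of x^a, which by Gamma(z + 1) = z Gamma(z) is a nonzero multiple, independent
   of a, of that of the Jacobi polynomial.  Square integrability is automatic,
   since eta takes values in [0, 1] almost surely. *)

(** * Gamma and Beta integrals *)

(** Differentiability is assumed at the endpoints too, so the one-sided limits there follow from
    continuity. The uses below are on compact intervals inside []0, +oo[] or []0, 1[]. *)
Lemma is_derive_FTC2 (R : realType) (f F : R -> R) (a b : R) :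
  a < b ->
  (forall x, a <= x <= b -> is_derive x 1 F (f x)) ->
  (forall x, a <= x <= b -> {for x, continuous f}) ->
  (\int[lebesgue_measure]_(x in `[a, b]) (f x)%:E = (F b)%:E - (F a)%:E)%E.
Proof.
move=> ab dF cf.
have cF x : a <= x <= b -> {for x, continuous F}.
  by move=> /dF [dFx _]; apply/differentiable_continuous/derivable1_diffP.
apply: continuous_FTC2 => //.
- apply: continuous_in_subspaceT => x; rewrite inE/= in_itv/=; exact: cf.
- split.
  + by move=> x; rewrite in_itv/= => /andP[/ltW ax /ltW xb];
      have [] := dF x (introT andP (conj ax xb)).
  + by apply: cvg_at_right_filter; apply: cF; rewrite lexx ltW.
  + by apply: cvg_at_left_filter; apply: cF; rewrite lexx ltW.
- move=> x; rewrite in_itv/= => /andP[/ltW ax /ltW xb].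
  by rewrite derive1E; have [] := dF x (introT andP (conj ax xb)).
Qed.

Lemma continuous_powR_gt0 (R : realType) (p x : R) :
  0 < x -> {for x, continuous (@powR R ^~ p)}.
Proof.
by move=> x0; have [dx _] := is_derive1_powR p x0;
  apply/differentiable_continuous/derivable1_diffP.
Qed.

(** With [s = 2 * p + 1], the inequality [ln (t / s) < t / s] gives
    [p * ln t <= p * ln s + p * (t / s)], and [p / s <= 1 / 2]. The summand 1 keeps [s] positive
    when [p = 0]. *)
Lemma powR_expRN_le (R : realType) (p : R) : 0 <= p ->
  exists2 C : R, 0 <= C &
    forall t, 0 < t -> t `^ p * expR (- t) <= C * expR (- t / 2).
Proof.
move=> p0; exists (expR (p * ln (2 * p + 1))); first exact: expR_ge0.
move=> t t0; rewrite /powR gt_eqF// -!expRD ler_expR.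
have c0 : 0 < 2 * p + 1 by lra.
have := @ln_sublinear _ (t / (2 * p + 1)); rewrite divr_gt0// => /(_ isT).
rewrite ln_div ?posrE// ltrBlDr => /ltW/(ler_wpM2l p0).
rewrite mulrDr => h; rewrite -lerBrDr; apply: (le_trans h).
have : p * (t / (2 * p + 1)) <= t / 2.
  rewrite mulrA ler_pdivrMr// [leRHS](_ : _ = p * t + t / 2); last by field.
  by rewrite lerDl ltW// divr_gt0.
lra.
Qed.

(** A nonnegative function with zero integral vanishes almost everywhere; for [f > 0] on [D] this
    would make [D] negligible. *)
Lemma integral_gt0 (d : measure_display) (T : measurableType d) (R : realType)
    (mu : {measure set T -> \bar R}) (D : set T) (f : T -> R) :
  measurable D -> mu D != 0%E -> measurable_fun D f ->
  (forall x, D x -> 0 < f x) -> (0 < \int[mu]_(x in D) (f x)%:E)%E.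
Proof.
move=> mD muD mf f0; rewrite lt_neqAle integral_ge0 ?andbT; last first.
  by move=> x /f0; rewrite lee_fin => /ltW.
apply/eqP => /esym int0; move/negP: muD; apply.
have /measurable_EFinP mfE := mf.
have /(ae_eq_integral_abs mu mD mfE) D0 :
    (\int[mu]_(x in D) `|(EFin \o f) x| = 0)%E.
  rewrite -int0; apply: eq_integral => x /set_mem /f0 fx0 /=.
  by rewrite ger0_norm// ltW.
apply/eqP/(negligibleP mu mD); apply: negligibleS D0 => x Dx /=.
by move=> /(_ Dx) [fx]; have := f0 x Dx; rewrite fx ltxx.
Qed.

Lemma cvg_invSSn (R : realType) : (n.+2%:R^-1 : R) @[n --> \oo] --> 0.
Proof. by have := @cvg_harmonic R; rewrite -(cvg_shiftS (@harmonic R)). Qed.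

Lemma cvgr_SSn (R : realType) : (n.+2%:R : R) @[n --> \oo] --> +oo.
Proof.
have := @cvgr_idn R; rewrite -(cvg_shiftS (fun n => n%:R : R)).
by rewrite -(cvg_shiftS (fun n => n.+1%:R : R)).
Qed.

(* Integration by parts on [1 / (n + 2), n + 2], where the integrands are
   continuous, and then n --> oo: for z < 1 the right-hand one is unbounded
   near 0. *)
Lemma gammaS_integral (R : realType) (z : R) : 0 < z ->
  (\int[lebesgue_measure]_(t in `]0%R, +oo[) (t `^ z * expR (- t))%:E =
   z%:E * \int[lebesgue_measure]_(t in `]0%R, +oo[) (t `^ (z - 1) * expR (- t))%:E)%E.
Proof.
move=> z0.
pose mu := @lebesgue_measure R.
pose D (n : nat) := `[(n.+2%:R^-1 : R), n.+2%:R]%classic.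
have Dgt0 n x : D n x -> 0 < x.
  by rewrite /D/= in_itv/= => /andP[+ _]; apply: lt_le_trans; rewrite invr_gt0.
have ndD : nondecreasing_seq D.
  move=> m n mn; apply/subsetPset; apply: subset_itv; rewrite bnd_simp.
  - by rewrite lef_pV2 ?posrE// ler_nat !ltnS.
  - by rewrite ler_nat !ltnS.
have mD n : measurable (D n) by exact: measurable_itv.
have bigD : \bigcup_n D n = `]0%R, +oo[%classic.
  apply/seteqP; split=> [x [n _ /Dgt0]|x]; first by rewrite /= in_itv/= andbT.
  rewrite /= in_itv/= andbT => x0.
  exists (Num.bound (Num.max x x^-1)) => //; rewrite /D/= in_itv/=.
  set m := Num.bound _.
  have : Num.max x x^-1 <= m.+2%:R.
    have := archi_boundP (_ : 0 <= Num.max x x^-1).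
    rewrite le_max ltW//= => /(_ isT) /ltW /le_trans; apply.
    by rewrite ler_nat -/m; lia.
  rewrite ge_max => /andP[-> xm]; rewrite andbT.
  by rewrite -[leRHS]invrK lef_pV2 ?posrE ?invr_gt0.
have cg (p x : R) : 0 < x -> {for x, continuous (fun t => t `^ p * expR (- t))}.
  move=> x0; apply: continuousM; first exact: continuous_powR_gt0.
  by apply: continuous_comp; [exact: continuousN|exact: continuous_expR].
have mg (p : R) A : measurable_fun A (fun t : R => (t `^ p * expR (- t))%:E).
  apply/measurable_EFinP/measurable_funTS/measurable_funM.
    exact: measurable_powR.
  by apply: measurableT_comp => //; exact: measurable_expR.
have cvgD (p : R) : (\int[mu]_(t in D i) (t `^ p * expR (- t))%:E @[i --> \oo] -->
    \int[mu]_(t in `]0%R, +oo[) (t `^ p * expR (- t))%:E)%E.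
  rewrite -bigD; apply: ge0_nondecreasing_set_cvg_integral => //.
    by move=> n; exact: mg.
  by move=> n x _; rewrite lee_fin mulr_ge0 ?powR_ge0 ?expR_ge0.
have intD (p : R) n : mu.-integrable (D n) (fun t => (t `^ p * expR (- t))%:E).
  apply: continuous_compact_integrable; first exact: segment_compact.
  by apply: continuous_in_subspaceT => x /set_mem /Dgt0; exact: cg.
(* The derivative of [F] is [z] times the right-hand integrand minus the left-hand one. *)
pose F (t : R) := t `^ z * expR (- t).
have FTC n : (z%:E * \int[mu]_(t in D n) (t `^ (z - 1) * expR (- t))%:E =
    \int[mu]_(t in D n) (t `^ z * expR (- t))%:E +
    (F n.+2%:R - F n.+2%:R^-1)%:E)%E.
  have <- : (\int[mu]_(t in D n) (z * (t `^ (z - 1) * expR (- t))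
      - t `^ z * expR (- t))%:E = (F n.+2%:R - F n.+2%:R^-1)%:E)%E.
    rewrite EFinB; apply: is_derive_FTC2.
    - by rewrite (lt_le_trans (y := 1))// ?ler1n// invf_lt1 ?ltr0n// ltr1n.
    - move=> x /andP[x0 _].
      have {}x0 : 0 < x by apply: lt_le_trans x0; rewrite invr_gt0.
      have := is_derive1_powR z x0 => ?.
      apply: is_derive_eq => /=.
      rewrite /GRing.scale/=; ring.
    - move=> x /andP[x0 _].
      have {}x0 : 0 < x by apply: lt_le_trans x0; rewrite invr_gt0.
      apply: continuousB; last exact: cg.
      by apply: continuousM; [exact: cvg_cst|exact: cg].
  under [X in _ = (_ + X)%E]eq_integral do rewrite EFinB EFinM.
  have iz : mu.-integrable (D n)
      (fun t => z%:E * (t `^ (z - 1) * expR (- t))%:E)%E.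
    by apply: integrableZl; [exact: measurable_itv|exact: intD].
  rewrite integralB//; last exact: measurable_itv.
  rewrite integralZl//; last exact: measurable_itv.
  rewrite [RHS]addeC subeK//; apply: integrable_fin_num => //.
  exact: measurable_itv.
(* The boundary terms vanish: at infinity by exponential decay, at 0 because [z > 0]. *)
have F0 : (F n.+2%:R - F n.+2%:R^-1) @[n --> \oo] --> 0.
  rewrite -[X in _ --> X]subr0; apply: cvgB.
    have [C C0 hC] := powR_expRN_le (ltW z0).
    apply: (@squeeze_cvgr _ _ _ _ (cst 0) (fun n => C * expR (- (n.+2%:R / 2)))).
    - by apply: nearW => n; rewrite /= /F mulr_ge0 ?powR_ge0 ?expR_ge0//=
        -mulNr hC.
    - exact: cvg_cst.
    - rewrite -[X in _ --> X](mulr0 C); apply: cvgM; first exact: cvg_cst.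
      apply: (@cvg_comp _ _ _ (fun n => n.+2%:R : R) (fun x => expR (- (x / 2)))).
        exact: cvgr_SSn.
      apply: (@cvg_comp _ _ _ (fun x : R => x / 2) (fun x => expR (- x)) _
        (pinfty_nbhs R)); last exact: cvgr_expR.
      by apply: gt0_cvgMly; [rewrite invr_gt0|exact: cvg_id].
  have -> : 0 = 0 * expR (- 0) :> R by rewrite mul0r.
  apply: cvgM.
    move/cvg_at_rightP: (powR_cvg0 z0); apply; split; last exact: cvg_invSSn.
    by move=> n; rewrite invr_gt0.
  apply: (@cvg_comp _ _ _ (fun n => - n.+2%:R^-1 : R) expR); last exact: continuous_expR.
  by apply: cvgN; exact: cvg_invSSn.
(* One sequence has both sides as limits. These limits are taken in the extended reals, as
   finiteness is not known yet. *)
have cz := cvgeZl (isT : z%:E \is a fin_num) (cvgD (z - 1)).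
have cz' : (z%:E * \int[mu]_(t in D i) (t `^ (z - 1) * expR (- t))%:E
    @[i --> \oo] --> \int[mu]_(t in `]0%R, +oo[) (t `^ z * expR (- t))%:E)%E.
  rewrite (funext FTC) -[X in _ --> X]adde0; apply: cvgeD => //.
    exact: fin_num_adde_defl.
  by apply: cvg_EFin => //; exact: nearW.
exact: (cvg_unique _ cz' cz).
Qed.

(** A nonnegative exponent is handled by comparison with a multiple of [exp (- t / 2)]. The exponent
    [z - 1], possibly negative, is reached from the exponent [z] through [gammaS_integral]. *)
Lemma gamma_integral_lty (R : realType) (z : R) : 0 < z ->
  (\int[lebesgue_measure]_(t in `]0%R, +oo[) (t `^ (z - 1) * expR (- t))%:E
    < +oo)%E.
Proof.
have mg (p : R) A : measurable_fun A (fun t : R => (t `^ p * expR (- t))%:E).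
  apply/measurable_EFinP/measurable_funTS/measurable_funM.
    exact: measurable_powR.
  by apply: measurableT_comp => //; exact: measurable_expR.
have step (p : R) : 0 <= p ->
    (\int[lebesgue_measure]_(t in `]0%R, +oo[) (t `^ p * expR (- t))%:E < +oo)%E.
  move=> p0; have [C C0 hC] := powR_expRN_le p0.
  have r0 : 0 < 2^-1 :> R by rewrite invr_gt0.
  (* The factor 2 cancels the rate 1/2 in front of the exponential density. *)
  have intE : lebesgue_measure.-integrable `]0%R, +oo[
      (fun x : R => (C * 2)%:E * (exponential_pdf 2^-1 x)%:E)%E.
    apply: integrableZl; first exact: measurable_itv.
    by apply: integrableS (integrable_exponential_pdf r0).
  apply: (@le_lt_trans _ _ (\int[lebesgue_measure]_(t in `]0%R, +oo[)
      ((C * 2)%:E * (exponential_pdf 2^-1 t)%:E))%E); last first.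
    by apply: integrable_lty => //; exact: measurable_itv.
  apply: ge0_le_integral.
  - exact: measurable_itv.
  - by move=> x _; rewrite lee_fin mulr_ge0 ?powR_ge0 ?expR_ge0.
  - exact: mg.
  - exact: measurable_int intE.
  - move=> x; rewrite /= in_itv/= andbT => x0.
    rewrite exponential_pdfE; last exact: ltW.
    rewrite -EFinM lee_fin.
    apply: le_trans (hC x x0) _; rewrite mulrA -(mulrA C) divff// mulr1.
    by rewrite !mulNr (mulrC x).
move=> z0; have := step z (ltW z0); rewrite gammaS_integral// => h.
by rewrite -(@lte_pmul2l _ z%:E) ?lte_fin// gt0_muley ?lte_fin.
Qed.

(** Finiteness is part of the argument: [fine] sends an infinite integral to 0. *)
Lemma Gamma_gt0 (R : realType) (z : R) : 0 < z -> 0 < Gamma z.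
Proof.
move=> z0; apply: fine_gt0; rewrite gamma_integral_lty// andbT.
apply: integral_gt0.
- exact: measurable_itv.
- have : (@lebesgue_measure R) `]0%R, +oo[%classic != 0%E.
    by rewrite lebesgue_measure_itv/= ltry.
  exact.
- apply: measurable_funTS; apply: measurable_funM; first exact: measurable_powR.
  by apply: measurableT_comp => //; exact: measurable_expR.
- move=> t; rewrite /= in_itv/= andbT => t0.
  by rewrite mulr_gt0 ?powR_gt0 ?expR_gt0.
Qed.

Lemma GammaS (R : realType) (z : R) : 0 < z -> Gamma (z + 1) = z * Gamma z.
Proof.
move=> z0; rewrite /Gamma /Rintegral addrK gammaS_integral// fineM//.
by rewrite ge0_fin_numE ?gamma_integral_lty// integral_ge0// => t _;
  rewrite lee_fin mulr_ge0 ?powR_ge0 ?expR_ge0.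
Qed.

Lemma GammaDn (R : realType) (z : R) (n : nat) : 0 < z ->
  Gamma (z + n%:R) = \prod_(j < n) (z + j%:R) * Gamma z.
Proof.
move=> z0; elim: n => [|n IHn]; first by rewrite big_ord0 addr0 mul1r.
rewrite -natr1 addrA GammaS ?ltr_wpDr// IHn big_ord_recr/=; ring.
Qed.

Lemma powR_le1 (R : realType) (x p : R) : 0 <= x <= 1 -> 0 <= p -> x `^ p <= 1.
Proof.
move=> /andP[x0 x1] p0.
by have := ge0_ler_powR p0 x0 ler01 x1; rewrite powR1.
Qed.

(** As for Gamma, finiteness is the main point. It follows from [g <= h] on []0, 1[]: the sum [h]
    separates the two singularities and has an explicit primitive. *)
Lemma Beta_gt0 (R : realType) (a b : R) : 0 < a -> 0 < b -> 0 < Beta a b.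
Proof.
move=> a0 b0; pose mu := @lebesgue_measure R.
pose g (t : R) := t `^ (a - 1) * (1 - t) `^ (b - 1).
pose h (t : R) := t `^ (a - 1) + (1 - t) `^ (b - 1).
have mp (p : R) : measurable_fun setT (fun t : R => (1 - t) `^ p).
  by apply: (measurableT_comp (measurable_powR p)); exact: measurable_funB.
have mg A : measurable_fun A g.
  by apply: measurable_funTS; apply: measurable_funM => //; exact: measurable_powR.
have mh A : measurable_fun A h.
  by apply: measurable_funTS; apply: measurable_funD => //; exact: measurable_powR.
have mhE A : measurable_fun A (fun t => (h t)%:E) by apply/measurable_EFinP.
have mgE A : measurable_fun A (fun t => (g t)%:E) by apply/measurable_EFinP.
(* The shift by 3 gives [1 / (n + 3) < 1 / 2], so the interval is nondegenerate. *)
pose D (n : nat) := `[(n.+3%:R^-1 : R), 1 - n.+3%:R^-1]%classic.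
have Dgt0 n x : D n x -> 0 < x < 1.
  rewrite /D/= in_itv/= => /andP[h1 h2].
  have : 0 < n.+3%:R^-1 :> R by rewrite invr_gt0.
  by move: h1 h2; move: (n.+3%:R^-1) => e h1 h2 e0; apply/andP; split; lra.
have mD n : measurable (D n) by exact: measurable_itv.
have ndD : nondecreasing_seq D.
  move=> m n mn; apply/subsetPset; apply: subset_itv; rewrite bnd_simp ?lerB//;
    by rewrite lef_pV2 ?posrE// ler_nat !ltnS.
have bigD : \bigcup_n D n = `]0%R, 1%R[%classic.
  apply/seteqP; split=> [x [n _ /Dgt0]|x]; first by rewrite /= in_itv/=.
  rewrite /= in_itv/= => /andP[x0 x1].
  have m0 : 0 < Num.min x (1 - x) by rewrite lt_min x0 subr_gt0.
  exists (Num.bound (Num.min x (1 - x))^-1) => //; rewrite /D/= in_itv/=.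
  set m := Num.bound _.
  have : m.+3%:R^-1 <= Num.min x (1 - x).
    rewrite -[leRHS]invrK lef_pV2 ?posrE ?invr_gt0//.
    have := archi_boundP (_ : 0 <= (Num.min x (1 - x))^-1).
    rewrite invr_ge0 (ltW m0) => /(_ isT) /ltW /le_trans; apply.
    by rewrite ler_nat -/m; lia.
  by rewrite le_min => /andP[-> xm] /=; rewrite lerBrDr -lerBrDl.
have intDh n : (\int[mu]_(t in D n) (h t)%:E <= (a^-1 + b^-1)%:E)%E.
  have n3 : n.+3%:R^-1 < 2^-1 :> R by rewrite ltf_pV2 ?posrE// ltr_nat.
  have n30 : 0 < n.+3%:R^-1 :> R by rewrite invr_gt0.
  rewrite /D; move: (n.+3%:R^-1) n3 n30 => e n3 n30.
  (* A primitive of [h]. On [[0, 1]] its two terms are bounded by [1 / a] and [1 / b], independently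
     of [e]. *)
  pose F (t : R) := t `^ a / a - (1 - t) `^ b / b.
  have -> : (\int[mu]_(t in `[e, (1 - e)%R]) (h t)%:E = (F (1 - e))%:E - (F e)%:E)%E.
    apply: is_derive_FTC2.
    - by lra.
    - move=> x /andP[x0 x1].
      have {}x0 : 0 < x by lra.
      have {}x1 : 0 < 1 - x by lra.
      have da := is_derive1_powR a x0.
      have db : is_derive x 1 (fun t => (1 - t) `^ b) (- (b * (1 - x) `^ (b - 1))).
        have d1 : is_derive x 1 (fun t : R => 1 - t) (- 1).
          by apply: is_derive_eq; rewrite add0r mul1r.
        rewrite -[- (b * _)]mulrN1.
        exact: (@is_derive1_comp _ (@powR R ^~ b) _ x _ _ (is_derive1_powR b x1) d1).
      apply: is_derive_eq; rewrite /h /GRing.scale/= ; field.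
      by rewrite !gt_eqF.
    - move=> x /andP[x0 x1].
      have {}x0 : 0 < x by lra.
      have {}x1 : 0 < 1 - x by lra.
      apply: continuousD; first exact: continuous_powR_gt0.
      apply: (@continuous_comp _ _ _ (fun t : R => 1 - t) (@powR R ^~ (b - 1))).
        by apply: continuousB; [exact: cvg_cst|exact: cvg_id].
      exact: continuous_powR_gt0.
  rewrite -EFinB lee_fin.
  have pw (x p : R) : 0 <= x <= 1 -> 0 < p -> 0 <= x `^ p / p <= p^-1.
    move=> /andP[x0 x1] p0; rewrite divr_ge0 ?powR_ge0 ?(ltW p0)//=.
    rewrite -[leRHS]mul1r ler_wpM2r ?invr_ge0 ?(ltW p0)//.
    by apply: powR_le1; [apply/andP; split|exact: ltW].
  have := pw (1 - e) a; have := pw e a.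
  have := pw (1 - (1 - e)) b; have := pw (1 - e) b.
  have e01 : 0 <= e <= 1 by apply/andP; split; lra.
  have e01' : 0 <= 1 - e <= 1 by apply/andP; split; lra.
  have -> : 1 - (1 - e) = e by ring.
  move=> /(_ e01' b0)/andP[? ?] /(_ e01 b0)/andP[? ?].
  move=> /(_ e01 a0)/andP[? ?] /(_ e01' a0)/andP[? ?].
  rewrite /F; have -> : 1 - (1 - e) = e by ring.
  lra.
have hlty : (\int[mu]_(t in `]0%R, 1%R[) (h t)%:E < +oo)%E.
  apply: (@le_lt_trans _ _ (a^-1 + b^-1)%:E); last exact: ltry.
  have : (\int[mu]_(t in D n) (h t)%:E @[n --> \oo]
      --> \int[mu]_(t in `]0%R, 1%R[) (h t)%:E)%E.
    rewrite -bigD; apply: ge0_nondecreasing_set_cvg_integral => //.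
    - by move=> n; exact: mhE.
    - by move=> n x _; rewrite lee_fin addr_ge0 ?powR_ge0.
  move=> cvgh; apply: cvge_to_le cvgh _; exact: nearW.
apply: fine_gt0; apply/andP; split.
  apply: integral_gt0 => //.
  - have : (@lebesgue_measure R) `]0%R, 1%R[%classic != 0%E.
      by rewrite lebesgue_measure_itv/= lte_fin ltr01 oppr0 adde0 oner_neq0.
    exact.
  - exact: mg.
  - move=> t; rewrite /= in_itv/= => /andP[t0 t1].
    by rewrite mulr_gt0 ?powR_gt0// subr_gt0.
apply: le_lt_trans hlty; apply: ge0_le_integral.
- exact: measurable_itv.
- by move=> x _; rewrite lee_fin mulr_ge0 ?powR_ge0.
- exact: mgE.
- exact: mhE.
- (* [x + (1 - x) = 1] gives [g x <= h x]. *)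
  move=> x; rewrite /= in_itv/= => /andP[x0 x1]; rewrite lee_fin.
  have y0 : 0 < 1 - x by rewrite subr_gt0.
  have pw (y p : R) : 0 < y -> y < 1 -> 0 < p -> 0 <= y * y `^ (p - 1) <= 1.
    move=> y1 y2 p0; rewrite mulr_powRB1 ?(ltW y1)// powR_ge0/=.
    by rewrite powR_le1 ?ltW.
  have := pw x a x0 x1 a0; have := pw (1 - x) b y0 ltac:(lra) b0.
  have := powR_ge0 x (a - 1); have := powR_ge0 (1 - x) (b - 1).
  rewrite /h.
  move: (x `^ _) ((1 - x) `^ _) => u v u0 v0 hv hu.
  have -> : u * v = (x * u) * v + u * ((1 - x) * v) by ring.
  have [/andP[_ xu] /andP[_ yv]] := (hu, hv).
  rewrite addrC; apply: lerD.
    by rewrite -[leRHS]mulr1 ler_wpM2l.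
  by rewrite -[leRHS]mul1r ler_wpM2r.
Qed.

(** * Bernstein combinations and the Chu-Vandermonde identity *)

(** Induction on [a]: Pascal's rule splits the sum into the one for [(x, y)] and [y / x] times the
    one for [(x + 1, y - 1)]. Since [x + y] is the same for both pairs, the two closed forms share
    their numerator. *)
Lemma Vandermonde_prod (F : numFieldType) (x y : F) (a : nat) : 0 < x ->
  \sum_(m < a.+1) 'C(a, m)%:R * \prod_(j < m) ((y - j%:R) / (x + j%:R)) =
  \prod_(j < a) ((x + y + j%:R) / (x + j%:R)).
Proof.
elim: a x y => [|a IHa] x y x0; first by rewrite big_ord1 !big_ord0 bin0 mulr1.
pose t x y (m : nat) : F := \prod_(j < m) ((y - j%:R) / (x + j%:R)).
have tS m : t x y m.+1 = y / x * t (x + 1) (y - 1) m.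
  rewrite /t big_ord_recl/= subr0 addr0; congr (_ * _); apply: eq_bigr => i _.
  by rewrite /bump/= natrD opprD !addrA.
transitivity (\sum_(m < a.+1) 'C(a, m)%:R * t x y m +
    y / x * \sum_(m < a.+1) 'C(a, m)%:R * t (x + 1) (y - 1) m).
  rewrite big_ord_recl/= -/(t x y 0%N) bin0.
  under eq_bigr => i _ do rewrite /bump/= add1n binS natrD mulrDl -/(t x y i.+1).
  rewrite big_split/= addrA; congr (_ + _).
    rewrite [in RHS]big_ord_recl/= bin0; congr (_ + _).
    rewrite [in LHS]big_ord_recr/= bin_small// mul0r addr0.
    by apply: eq_bigr => i _; rewrite /bump/= add1n.
  by rewrite mulr_sumr; apply: eq_bigr => i _; rewrite tS mulrCA.
rewrite (IHa x y)// (IHa (x + 1) (y - 1)) ?addr_gt0//.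
have xn0 (j : nat) : x + j%:R != 0 by rewrite gt_eqF// ltr_wpDr.
rewrite !prodf_div big_ord_recr [in X in _ = _ / X]big_ord_recr/=.
have -> : \prod_(j < a) (x + 1 + (y - 1) + j%:R) = \prod_(j < a) (x + y + j%:R).
  by apply: eq_bigr => i _; rewrite addrACA subrr addr0.
have eqP : \prod_(j < a) (x + 1 + j%:R) = \prod_(j < a) (x + j%:R) * (x + a%:R) / x.
  transitivity (\prod_(j < a.+1) (x + j%:R) / x); last by rewrite big_ord_recr.
  rewrite big_ord_recl/= addr0 [x * _]mulrC mulfK; last by have := xn0 0; rewrite addr0.
  by apply: eq_bigr => i _; rewrite /bump/= natrD addrA.
rewrite eqP; set p := \prod_(j < a) (x + y + _); set q := \prod_(j < a) _.
have q0 : q != 0 by apply/prodf_neq0 => i _.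
by field; rewrite q0 (xn0 a) gt_eqF.
Qed.

Lemma coef_exp_1BX (F : comNzRingType) (k j : nat) :
  ((1 - 'X) ^+ k : {poly F})`_j = (-1) ^+ j * 'C(k, j)%:R.
Proof.
have -> : (1 - 'X) ^+ k = \poly_(i < k.+1) ((-1) ^+ i * 'C(k, i)%:R) :> {poly F}.
  rewrite exprBn poly_def; apply: eq_bigr => i _.
  by rewrite expr1n mulr1 mulr_natr -scalerMnl -mul_polyC rmorphXn rmorphN1.
rewrite coef_poly ltnS; case: leqP => // jk.
by rewrite bin_small// mulr0.
Qed.

(** Multiplied by [m! (a - m)! (n - a)!], both sides become [n!]. *)
Lemma bin_trinomial (n a m : nat) : (m <= a)%N -> (a <= n)%N ->
  ('C(n, m) * 'C(n - m, a - m) = 'C(n, a) * 'C(a, m))%N.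
Proof.
move=> ma an; have mn := leq_trans ma an.
have h1 := bin_fact mn; have h2 := bin_fact an; have h3 := bin_fact ma.
have h4 := bin_fact (leq_sub2r m an).
have e : (n - m - (a - m) = n - a)%N by lia.
rewrite e in h4.
apply/eqP; rewrite -(eqn_pmul2r (fact_gt0 m)) -(eqn_pmul2r (fact_gt0 (a - m))).
rewrite -(eqn_pmul2r (fact_gt0 (n - a))); apply/eqP.
transitivity n`!; first by rewrite -h1 -h4; ring.
by rewrite -h2 -h3; ring.
Qed.

(** For [f m = phi (ones_zeros n m)] this is the polynomial in [eta] that defines the chaos of order
    [n]. *)
Definition bernstein_comb (F : comNzRingType) (n : nat) (f : nat -> F) : {poly F} :=
  \sum_(m < n.+1) ('C(n, m)%:R * f m) *: ('X^m * (1 - 'X) ^+ (n - m)).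

(** The sum on the right is the [a]-th finite difference of [f] at 0. It appears when
    [(1 - X) ^ (n - m)] is expanded and [bin_trinomial] moves the dependence on [n] out of the
    sum. *)
Lemma coef_bernstein_comb (F : comNzRingType) (n : nat) (f : nat -> F) (a : nat) :
  (bernstein_comb n f)`_a =
    'C(n, a)%:R * \sum_(m < a.+1) 'C(a, m)%:R * (-1) ^+ (a - m) * f m.
Proof.
rewrite coef_sum; have [an|na] := leqP a n; last first.
  rewrite (bin_small na) mul0r big1// => m _.
  rewrite coefZ coefXnM coef_exp_1BX (@bin_small (n - m)) ?mulr0 ?if_same ?mulr0//.
  by have := ltn_ord m; lia.
rewrite mulr_sumr (big_ord_widen n.+1 (fun m =>
   'C(n, a)%:R * ('C(a, m)%:R * (-1) ^+ (a - m) * f m)))//.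
rewrite [RHS]big_mkcond/=; apply: eq_bigr => m _.
rewrite coefZ coefXnM ltnS ltnNge; case: leqP => [ma|]; last by rewrite mulr0.
rewrite /= coef_exp_1BX.
have := bin_trinomial ma an => /(congr1 (fun k => k%:R : F)); rewrite !natrM => h.
by rewrite !mulrA -h; ring.
Qed.

(** Alternating values absorb the signs of the finite difference and leave a sum of the kind
    evaluated by [Vandermonde_prod]. *)
Lemma coef_bernstein_comb_sign (F : comNzRingType) (n : nat) (t : nat -> F) (a : nat) :
  (bernstein_comb n (fun m => (-1) ^+ m * t m))`_a =
    'C(n, a)%:R * (-1) ^+ a * \sum_(m < a.+1) 'C(a, m)%:R * t m.
Proof.
rewrite coef_bernstein_comb -mulrA; congr (_ * _).
rewrite mulr_sumr; apply: eq_bigr => m _.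
have -> : (-1) ^+ a = (-1) ^+ (a - m) * (-1) ^+ m :> F.
  by rewrite -exprD subnK// -ltnS.
ring.
Qed.

(** The two polynomials are compared coefficient by coefficient. With [n = k.+1] one has
    [al1 + al0 + n - 1 = al1 + al0 + k > 0], so every Gamma argument is positive. *)
Lemma modified_jacobiE (R : realType) (al1 al0 : R) (k : nat) :
  0 < al1 -> 0 < al0 ->
  exists2 K : R, K != 0 & modified_jacobi al1 al0 k.+1 =
    K *: bernstein_comb k.+1 (fun m =>
      (-1) ^+ m * \prod_(j < m) ((al0 + k%:R - j%:R) / (al1 + j%:R))).
Proof.
move=> al1_gt0 al0_gt0; set n := k.+1.
have g0 (z : R) : 0 < z -> Gamma z != 0 by move=> /Gamma_gt0; rewrite lt0r => /andP[].
have s0 : 0 < al1 + al0 + k%:R by rewrite ltr_wpDr// addr_gt0.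
have norm_gt0 : 0 < jacobi_norm al1 al0 n.
  rewrite /jacobi_norm.
  have e1 : 2 * n%:R + al1 + al0 - 1 = al1 + al0 + (k + n)%:R.
    by rewrite /n natrD -natr1; ring.
  have e2 : 2 * n%:R + al0 + al1 - 1 = al1 + al0 + (k + n)%:R.
    by rewrite /n natrD -natr1; ring.
  have e3 : n%:R + al1 + al0 - 1 = al1 + al0 + k%:R.
    by rewrite /n -natr1; ring.
  rewrite e1 e2 e3.
  have s1 : 0 < al1 + al0 + (k + n)%:R by rewrite ltr_wpDr// addr_gt0.
  rewrite mulr_gt0 ?Beta_gt0// divr_gt0//.
    by rewrite mulr_gt0// exprn_gt0// Gamma_gt0.
  by rewrite !mulr_gt0 ?ltr0n ?fact_gt0 ?Gamma_gt0// ltr_wpDl.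
(* What remains of [jacobi_coef] once the binomial coefficient, the sign [(-1) ^ a] and the two
   rising products given by [GammaDn] are taken out. *)
pose c : R := (-1) ^+ n * Gamma (al1 + n%:R) * Gamma (al1 + al0 + k%:R)
  / (Gamma (al1 + al0 - 1 + 2 * n%:R) * Gamma al1).
have G1 : Gamma (al1 + n%:R) != 0 by rewrite g0// ltr_wpDr.
have G2 : Gamma (al1 + al0 - 1 + 2 * n%:R) != 0.
  apply: g0; have -> : al1 + al0 - 1 + 2 * n%:R = al1 + al0 + k%:R + n%:R.
    by rewrite /n -natr1; ring.
  by rewrite ltr_wpDr.
have G3 : Gamma (al1 + al0 + k%:R) != 0 by exact: g0.
have G4 : Gamma al1 != 0 by exact: g0.
have c0 : c != 0.
  have sn : (-1) ^+ n != 0 :> R by rewrite signr_eq0.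
  exact: (mulf_neq0 (mulf_neq0 (mulf_neq0 sn G1) G3)
    (invr_neq0 (mulf_neq0 G2 G4))).
exists (Num.sqrt (jacobi_norm al1 al0 n) * c).
  by rewrite mulf_neq0// sqrtr_eq0 -ltNge.
rewrite /modified_jacobi/= -scalerA; congr (_ *: _).
apply/polyP => a; rewrite coef_poly coefZ ltnS.
rewrite coef_bernstein_comb_sign Vandermonde_prod//.
case: leqP => [an|na]; last by rewrite bin_small// !mul0r mulr0.
rewrite /jacobi_coef prodf_div.
have -> : al1 + (al0 + k%:R) = al1 + al0 + k%:R by rewrite addrA.
have -> : al1 + al0 - 1 + a%:R + n%:R = al1 + al0 + k%:R + a%:R.
  by rewrite /n -natr1; ring.
rewrite (addrC a%:R) (GammaDn a s0) (GammaDn a al1_gt0) /c.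
have -> : (-1) ^+ (n - a) = (-1) ^+ n * (-1) ^+ a :> R.
  by rewrite -[in RHS](subnK an) exprD -mulrA -expr2 sqrr_sign mulr1.
have p0 : \prod_(i < a) (al1 + i%:R) != 0.
  by apply/prodf_neq0 => i _; rewrite gt_eqF// ltr_wpDr.
move: (Gamma (al1 + n%:R)) (Gamma (al1 + al0 - 1 + 2 * n%:R)) (Gamma al1)
  (Gamma (al1 + al0 + k%:R)) G1 G2 G3 G4 => x1 x2 x3 x4 h1 h2 h3 h4.
move: (\prod_(i < a) (al1 + i%:R)) p0 => p p0.
by field; rewrite h2 h4 p0.
Qed.

(** * Cylinders of the Polya sequence *)

Section prefix.
Context (R : realType) (d : measure_display) (T : measurableType d).
Variables (P : probability T R) (X : nat -> {RV P >-> bool}).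
Implicit Types n k : nat.

(** The cylinders partition the space, and [prefix_sigma_algebra X n] consists of their unions. *)
Definition cyl n (a : n.-tuple bool) : set T :=
  [set w | prefix_vector X n w = a].

Lemma cylE n (a : n.-tuple bool) :
  cyl a = [set w | forall i : 'I_n, X i w = tnth a i].
Proof.
apply/seteqP; split=> w /=; first by move=> <- i; rewrite tnth_mktuple.
by move=> h; apply: eq_from_tnth => i; rewrite tnth_mktuple.
Qed.

Lemma cyl_bigcap n (a : n.-tuple bool) :
  cyl a = \big[setI/setT]_(i < n) (X i @^-1` [set tnth a i]).
Proof.
rewrite cylE; apply/seteqP; split=> w /= h.
  by apply: (big_ind (fun A : set T => A w)) => // i _; exact: h.
by move=> i; move: h; rewrite (bigD1 i)//= => -[].
Qed.

Lemma measurable_cyl n (a : n.-tuple bool) : measurable (cyl a).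
Proof.
rewrite cyl_bigcap; apply: (big_ind (fun A : set T => measurable A)) => //.
  by move=> A B; exact: measurableI.
move=> i _; rewrite -[X in measurable X]setTI.
exact: (measurable_funPT (X i)).
Qed.

(** Presents a function of the first [n] variables as a simple function, so that its integral
    reduces to probabilities of cylinders. *)
Lemma prefix_indicE n (g : n.-tuple bool -> R) (w : T) :
  (g (prefix_vector X n w))%:E =
  (\sum_t (g t)%:E * (\1_(cyl t) w)%:E)%E.
Proof.
rewrite (bigD1 (prefix_vector X n w))//= big1 ?adde0 => [|t tw].
  by rewrite indicE mem_set// mule1.
rewrite indicE memNset ?mule0//= => wt; move/eqP: tw; apply.
by rewrite -wt.
Qed.

Lemma integrable_prefix n (g : n.-tuple bool -> R) :
  P.-integrable setT (fun w => (g (prefix_vector X n w))%:E).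
Proof.
under eq_fun do rewrite prefix_indicE.
apply: integrable_sum => // t _; apply: integrableZl => //.
by apply: integrable_indic => //; exact: measurable_cyl.
Qed.

Lemma integral_prefix n (g : n.-tuple bool -> R) :
  (\int[P]_w (g (prefix_vector X n w))%:E = \sum_t (g t)%:E * P (cyl t))%E.
Proof.
under eq_integral do rewrite prefix_indicE.
have ii t : P.-integrable setT (fun w => (\1_(@cyl n t) w)%:E).
  by apply: integrable_indic => //; exact: measurable_cyl.
rewrite integral_sum//; last by move=> t; exact: integrableZl.
apply: eq_bigr => t _; rewrite integralZl// integral_indic//.
  by rewrite setIT.
exact: measurable_cyl.
Qed.

(** The preimages of arbitrary sets of tuples form a sigma-algebra that contains the generators. *)
Lemma prefix_sigma_algebra_preimage n (A : set T) :
  prefix_sigma_algebra X n A ->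
  exists S : set (n.-tuple bool), A = prefix_vector X n @^-1` S.
Proof.
suff : prefix_sigma_algebra X n `<=`
    [set B | exists S : set (n.-tuple bool), B = prefix_vector X n @^-1` S] by exact.
apply: smallest_sub.
  split=> /=.
  - by exists set0; rewrite preimage_set0.
  - by move=> B [S ->]; exists (~` S); rewrite setTD preimage_setC.
  - move=> F hF; exists (\bigcup_i (projT1 (cid (hF i)))).
    rewrite preimage_bigcup; apply: eq_bigcupr => i _.
    exact: projT2 (cid (hF i)).
apply: (big_ind (fun G : set (set T) => G `<=` _)) => //.
  by move=> G1 G2 h1 h2; rewrite subUset.
move=> i _ B [C _ <-]; rewrite setTI.
exists [set t | C (tnth t i)]; apply/seteqP; split=> w /=;
  by rewrite tnth_mktuple.
Qed.

Lemma prefix_sigma_algebra_cyl n (a : n.-tuple bool) :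
  prefix_sigma_algebra X n (cyl a).
Proof.
rewrite cyl_bigcap; apply: (big_ind (fun A => prefix_sigma_algebra X n A)).
- exact: (@measurableT _ (g_sigma_algebraType _)).
- by move=> A B; exact: (@measurableI _ (g_sigma_algebraType _)).
- move=> i _; apply: sub_sigma_algebra; rewrite (bigD1 i)//=; left.
  by exists [set tnth a i]; rewrite ?setTI.
Qed.

End prefix.
Arguments cyl {R d T P} X [n] a.

(** * Appending an entry to a tuple, and counting ones *)

Lemma ord_recr_ind (k : nat) (Q : 'I_k.+1 -> Prop) :
  (forall i : 'I_k, Q (widen_ord (leqnSn k) i)) -> Q ord_max -> forall i, Q i.
Proof.
move=> Qw Qm i; have [j ->|->//] := unliftP ord_max i.
have -> : lift ord_max j = widen_ord (leqnSn k) j by apply/val_inj/lift_max.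
exact: Qw.
Qed.

Lemma tnth_rcons_widen (U : Type) (k : nat) (a : k.-tuple U) (b : U) (i : 'I_k) :
  tnth [tuple of rcons a b] (widen_ord (leqnSn k) i) = tnth a i.
Proof. by rewrite !(tnth_nth b)/= nth_rcons size_tuple ltn_ord. Qed.

Lemma tnth_rcons_max (U : Type) (k : nat) (a : k.-tuple U) (b : U) :
  tnth [tuple of rcons a b] ord_max = b.
Proof. by rewrite (tnth_nth b)/= nth_rcons size_tuple ltnn eqxx. Qed.

Definition belast_tuple (U : Type) (k : nat) (t : k.+1.-tuple U) : k.-tuple U :=
  [tuple tnth t (widen_ord (leqnSn k) i) | i < k].

Lemma rconsK_tuple (U : Type) (k : nat) (a : k.-tuple U) (b : U) :
  belast_tuple [tuple of rcons a b] = a.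
Proof. by apply: eq_from_tnth => i; rewrite tnth_mktuple tnth_rcons_widen. Qed.

Lemma rcons_belast_tuple (U : Type) (k : nat) (t : k.+1.-tuple U) :
  [tuple of rcons (belast_tuple t) (tnth t ord_max)] = t.
Proof.
apply: eq_from_tnth; apply: ord_recr_ind => [i|]; last by rewrite tnth_rcons_max.
by rewrite tnth_rcons_widen tnth_mktuple.
Qed.

Lemma sum_rcons_tuple (U : finType) (V : nmodType) (k : nat)
    (F : k.+1.-tuple U -> V) :
  \sum_t F t = \sum_(a : k.-tuple U) \sum_b F [tuple of rcons a b].
Proof.
rewrite pair_bigA/=.
rewrite (reindex (fun p : k.-tuple U * U => [tuple of rcons p.1 p.2]))//=.
exists (fun t => (belast_tuple t, tnth t ord_max)).
- by move=> [a b] _; rewrite rconsK_tuple tnth_rcons_max.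
- by move=> t _; exact: rcons_belast_tuple.
Qed.

Lemma belast_prefix_vector (R : realType) (d : measure_display)
    (T : measurableType d) (P : probability T R) (X : nat -> {RV P >-> bool})
    (k : nat) (w : T) :
  belast_tuple (prefix_vector X k.+1 w) = prefix_vector X k w.
Proof. by apply: eq_from_tnth => i; rewrite !tnth_mktuple. Qed.

Lemma count_mem_tnth (U : eqType) (V : nzSemiRingType) (k : nat) (a : k.-tuple U) (b : U) :
  \sum_(l < k) (tnth a l == b)%:R = (count_mem b a)%:R :> V.
Proof.
rewrite -natr_sum; congr _%:R; rewrite -sum1_count big_tuple [RHS]big_mkcond/=.
by apply: eq_bigr => l _; case: (_ == _).
Qed.

Lemma count_true_false (k : nat) (a : k.-tuple bool) :
  (count_mem false a = k - count_mem true a)%N.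
Proof.
rewrite -{2}(size_tuple a) -(count_predC (pred1 true) a) addKn.
by apply: eq_count; case.
Qed.

Lemma count_true_le (k : nat) (a : k.-tuple bool) : (count_mem true a <= k)%N.
Proof. by rewrite -{2}(size_tuple a) count_size. Qed.

Lemma count_ones_zeros (n m : nat) : (m <= n)%N ->
  count_mem true (ones_zeros n m) = m.
Proof.
move=> mn; rewrite -sum1_count big_tuple big_mkcond/=.
under eq_bigr do rewrite tnth_mktuple eqb_id.
rewrite -big_mkcond/= -(big_ord_widen n (fun=> 1%N) mn).
by rewrite sum1_card card_ord.
Qed.

(** Boolean tuples of equal length with the same number of [true] also have the same number of
    [false], hence are permutations of each other. *)
Lemma symmetric_fun_count (R : realType) (n : nat) (phi : n.-tuple bool -> R) :
  symmetric_fun phi -> forall a, phi a = phi (ones_zeros n (count_mem true a)).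
Proof.
move=> sphi a.
have ct := count_ones_zeros (count_true_le a).
have /tuple_permP[s /val_inj as_] : perm_eq a (ones_zeros n (count_mem true a)).
  apply/allP => b _ /=; apply/eqP; case: b; first by rewrite [RHS]ct.
  by rewrite [LHS]count_true_false [RHS]count_true_false ct card_ord.
by rewrite {1}as_ sphi.
Qed.

(** * The centering condition as a recurrence *)

Section polya.
Context (R : realType) (d : measure_display) (T : measurableType d).
Variables (P : probability T R) (al1 al0 : R) (X : nat -> {RV P >-> bool}).
Hypotheses (al1_gt0 : 0 < al1) (al0_gt0 : 0 < al0).
Hypothesis polyaX : polya_sequence al1 al0 X.

(** In the product for [rcons a b] the first [k] factors depend on [a] only, and the last one is the
    predictive probability of [b]. All factors are positive because both atoms have positive
    mass. *)
Lemma polya_cyl_gt0 k (a : k.-tuple bool) : exists2 p : R, 0 < p &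
  P (cyl X a) = p%:E /\ forall b, P (cyl X [tuple of rcons a b]) =
    (p * (polya_atom al1 al0 b + (count_mem b a)%:R) / (al1 + al0 + k%:R))%:E.
Proof.
exists (\prod_(i < k) ((polya_atom al1 al0 (tnth a i)
    + \sum_(l < k | (l < i)%N) (tnth a l == tnth a i)%:R)
  / (al1 + al0 + i%:R))).
  apply: prodr_gt0 => i _; apply: divr_gt0; last first.
    by apply: ltr_wpDr => //; exact: addr_gt0.
  apply: ltr_wpDr; first by apply: sumr_ge0.
  by rewrite /polya_atom; case: ifP.
split=> [|b]; first by rewrite cylE polyaX.
rewrite cylE polyaX big_ord_recr/= -[in RHS]mulrA; congr (_ * (_ / _))%:E.
  apply: eq_bigr => i _; rewrite tnth_rcons_widen; congr ((_ + _) / _).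
  (* The new index [k] never precedes [i < k], so these factors are unchanged. *)
  rewrite big_mkcond big_ord_recr/= [(k < i)%N]ltnNge ltnW ?ltn_ord//= addr0.
  by rewrite -big_mkcond/=; apply: eq_bigr => l _; rewrite tnth_rcons_widen.
rewrite tnth_rcons_max; congr (_ + _).
rewrite big_mkcond big_ord_recr/= ltnn addr0 -count_mem_tnth.
by apply: eq_bigr => l _; rewrite ltn_ord tnth_rcons_widen.
Qed.

(** Centering says that the integral over every cylinder of length [k] is zero. On one with [m]
    ones, the next entry is 1 or 0 with weights proportional to [al1 + m] and [al0 + (k - m)]. *)
Lemma XiP k (phi : k.+1.-tuple bool -> R) :
  Xi X phi <-> symmetric_fun phi /\
    forall m, (m <= k)%N ->
      phi (ones_zeros k.+1 m.+1) * (al1 + m%:R)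
      + phi (ones_zeros k.+1 m) * (al0 + (k - m)%:R) = 0.
Proof.
have s_gt0 : 0 < al1 + al0 + k%:R by rewrite ltr_wpDr// addr_gt0.
pose step (a : k.-tuple bool) := let m := count_mem true a in
  phi (ones_zeros k.+1 m.+1) * (al1 + m%:R)
      + phi (ones_zeros k.+1 m) * (al0 + (k - m)%:R).
(* Each cylinder contributes a positive multiple of the recurrence. *)
have intE (S : set (k.-tuple bool)) : symmetric_fun phi ->
    exists q : k.-tuple bool -> R, (forall a, 0 < q a) /\
    (\int[P]_(w in prefix_vector X k @^-1` S) (phi (prefix_vector X k.+1 w))%:E =
     (\sum_(a | a \in S) q a * step a)%:E)%E.
  move=> sphi.
  (* The weight is the probability of the cylinder of [a] divided by the total mass
     [al1 + al0 + k]. *)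
  exists (fun a => sval (cid2 (polya_cyl_gt0 a)) / (al1 + al0 + k%:R)); split.
    by move=> a; case: cid2 => p p0 _ /=; rewrite divr_gt0.
  rewrite integral_mkcond.
  (* The restriction to the event is absorbed into a function of the first [k.+1] variables. *)
  pose g t := phi t * (belast_tuple t \in S)%:R.
  transitivity (\int[P]_w (g (prefix_vector X k.+1 w))%:E)%E.
    apply: eq_integral => w _; rewrite patchE /g belast_prefix_vector.
    have -> : (w \in prefix_vector X k @^-1` S) = (prefix_vector X k w \in S).
      by apply/idP/idP; rewrite !inE.
    by case: ifP; rewrite ?mulr1 ?mulr0.
  rewrite integral_prefix sum_rcons_tuple -sumEFin [RHS]big_mkcond/=.
  apply: eq_bigr => a _.
  rewrite big_bool /g/= !rconsK_tuple.
  case: cid2 => p p0 /= [_ hb]; rewrite !hb /polya_atom -!EFinM -EFinD.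
  case: ifP => aS; last by rewrite !mulr0 !mul0r addr0.
  congr _%:E; rewrite /step !mulr1.
  have cr b : count_mem true [tuple of rcons a b] = (count_mem true a + b)%N.
    by rewrite /= -cats1 count_cat/= addn0; case: b.
  rewrite (symmetric_fun_count sphi [tuple of rcons a true]) cr addn1.
  rewrite (symmetric_fun_count sphi [tuple of rcons a false]) cr addn0.
  rewrite count_true_false; field.
  by rewrite gt_eqF.
split=> [[sphi [_ _ _ h]]|[sphi hrec]]; split=> //.
(* Testing on the single cylinder of [ones_zeros k m] isolates the recurrence at [m], whose weight
   is nonzero. *)
- move=> m mk; pose a := ones_zeros k m.
  have [q [q0 hq]] := intE [set a] sphi.
  have := h _ (@prefix_sigma_algebra_cyl _ _ _ _ X _ a).
  rewrite integral0_eq// => /esym; rewrite -[cyl X a]/(_ @^-1` [set a]) hq.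
  rewrite (big_pred1 a); last first.
    by move=> b /=; apply/idP/eqP; rewrite inE.
  move=> /eqP; rewrite eqe mulf_eq0 gt_eqF//= /step /a count_ones_zeros//.
  by move/eqP.
- split.
  + exact: integrable_prefix.
  + exact: integrable0.
  + move=> B _; rewrite preimage_cst; case: ifP => _.
      exact: (@measurableT _ (g_sigma_algebraType _)).
    exact: sigma_algebra0.
  + move=> A /prefix_sigma_algebra_preimage[S ->].
    rewrite integral0; have [q [_ ->]] := intE S sphi.
    by rewrite big1// => a _; rewrite /step hrec ?mulr0// count_true_le.
Qed.

End polya.

(** * The chaos spaces *)

Lemma horner_bernstein_comb (F : comNzRingType) (n : nat) (f : nat -> F) (x : F) :
  (bernstein_comb n f).[x] =
    \sum_(m < n.+1) 'C(n, m)%:R * f m * x ^+ m * (1 - x) ^+ (n - m).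
Proof.
rewrite horner_sum; apply: eq_bigr => m _.
by rewrite hornerZ hornerM !horner_exp hornerD hornerN hornerX hornerC mulrA.
Qed.

Lemma bernstein_combZ (F : comNzRingType) (n : nat) (f g : nat -> F) (c : F) :
  (forall m, (m <= n)%N -> f m = c * g m) ->
  bernstein_comb n f = c *: bernstein_comb n g.
Proof.
move=> fg; rewrite scaler_sumr; apply: eq_bigr => m _.
by rewrite fg ?scalerA 1?mulrCA// -ltnS.
Qed.

(** As [x + m] is nonzero, the recurrence yields [f m.+1] from [f m] with ratio
    [- (y + k - m) / (x + m)]. Its last instance, [m = k], gives [f k.+1]. *)
Lemma two_term_recurrence (F : numFieldType) (x y : F) (k : nat) (f : nat -> F) :
  0 < x ->
  (forall m, (m <= k)%N -> f m.+1 * (x + m%:R) + f m * (y + (k - m)%:R) = 0) <->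
  (forall m, (m <= k.+1)%N -> f m = f 0%N *
     ((-1) ^+ m * \prod_(j < m) ((y + k%:R - j%:R) / (x + j%:R)))).
Proof.
move=> x0; have xn0 j : x + j%:R != 0 by rewrite gt_eqF// ltr_wpDr.
split=> [h|h m mk]; last first.
  rewrite (h m.+1)// (h m) 1?leqW// big_ord_recr/= exprS natrB//; field.
  exact: xn0.
elim=> [|m IHm] mk; first by rewrite expr0 big_ord0 !mulr1.
have := h m mk; rewrite (IHm (ltnW mk)) natrB// => hm.
apply: (mulIf (xn0 m)); move/eqP: hm; rewrite addr_eq0 => /eqP ->.
by rewrite big_ord_recr/= exprS; field; exact: xn0.
Qed.

(** All averages lie in [[0, 1]], including the one for [n = 0], an empty sum equal to 0; the bounds
    pass to the limit. *)
Lemma mean_le1 (R : realType) (x : nat -> bool) (l : R) :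
  (fun n : nat => n%:R^-1 * \sum_(i < n) (x i)%:R) @ \oo --> l -> `|l| <= 1.
Proof.
move=> xl.
have x01 n : 0 <= (n%:R^-1 * \sum_(i < n) (x i)%:R : R) <= 1.
  rewrite mulr_ge0 ?invr_ge0 ?sumr_ge0//=.
  case: n => [|n]; first by rewrite big_ord0 mulr0.
  rewrite mulrC ler_pdivrMr// mul1r.
  rewrite -[n.+1 in leRHS]card_ord -sumr_const.
  by apply: ler_sum => i _; case: (x i).
have l0 : 0 <= l by apply: cvgr_to_ge xl _; apply: nearW => n; case/andP: (x01 n).
rewrite ger0_norm//.
by apply: cvgr_to_le xl _; apply: nearW => n; case/andP: (x01 n).
Qed.

Lemma horner_norm_le1 (F : numDomainType) (p : {poly F}) (x : F) :
  `|x| <= 1 -> `|p.[x]| <= \sum_(i < size p) `|p`_i|.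
Proof.
move=> x1; rewrite horner_coef; apply: le_trans (ler_norm_sum _ _ _) _.
by apply: ler_sum => i _; rewrite normrM normrX ler_piMr// exprn_ile1.
Qed.

(** A bounded variable is in L^oo, which is contained in L^2 for a finite measure. *)
Lemma ae_bounded_Lfun (R : realType) (d : measure_display)
    (T : measurableType d) (P : probability T R) (Y : {RV P >-> R}) (M : R) :
  {ae P, forall w, `|Y w| <= M} -> (Y : T -> R) \in Lfun P 2%:E.
Proof.
move=> YM; have Yoo : (Y : T -> R) \in Lfun P +oo%E.
  rewrite inE; apply/andP; split; rewrite inE//=.
  rewrite /finite_norm unlock; case: ifP => _ //.
  apply: (@le_lt_trans _ _ M%:E); last exact: ltry.
  by apply/ess_supP; apply: filterS YM => w /=; rewrite lee_fin.
apply: (@Lfun_subset _ _ _ P 2%:E +oo%E) Yoo => //.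
- by rewrite lee_fin ler1n.
- by rewrite leey.
- exact: fin_num_measure.
- by rewrite leey.
Qed.

Theorem proposition7 (R : realType) (d : measure_display)
    (T : measurableType d) (P : probability T R) (al1 al0 : R)
    (X : nat -> {RV P >-> bool}) (eta : {RV P >-> R}) :
  0 < al1 -> 0 < al0 ->
  polya_sequence al1 al0 X ->
  {ae P, forall w,
     (fun n : nat => n%:R^-1 * \sum_(i < n) (X i w)%:R) @ \oo --> eta w} ->
  forall (n : nat) (Y : {RV P >-> R}),
    chaos X eta n Y <->
    exists c : R,
      {ae P, forall w, Y w = c * (modified_jacobi al1 al0 n).[eta w]}.
Proof.
move=> al1_gt0 al0_gt0 polyaX cvg_eta [|k] Y.
  (* For [n = 0] the polynomial is 1, and both sides say that [Y] is almost surely constant. *)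
  split=> -[c hc]; exists c; apply: filterS hc => w;
    by rewrite /modified_jacobi/= hornerC mulr1.
have [K K0 JE] := modified_jacobiE k al1_gt0 al0_gt0.
(* [r] is the solution of the recurrence with [r 0 = 1]. *)
set r := fun m => _ * _ in JE; set n := k.+1 in JE *.
rewrite /chaos/=; split=> [[_ [phi /(XiP al1_gt0 al0_gt0 polyaX)[_ hphi] hY]]|[c hY]].
  pose f m := phi (ones_zeros n m).
  have /two_term_recurrence hf := hphi.
  (* Here [f] is [f 0] times [r], while the Jacobi polynomial is [K] times the combination of
     [r]. *)
  exists (f 0%N / K); apply: filterS hY => w ->.
  rewrite JE hornerZ mulrA divfK// -hornerZ -(@bernstein_combZ _ n f).
    by rewrite horner_bernstein_comb.
  by move=> m mn; rewrite /f hf.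
split; first split.
(* Almost surely [eta] is bounded by 1 in absolute value, so a polynomial in [eta] is bounded. *)
- pose J := modified_jacobi al1 al0 n.
  apply: (@ae_bounded_Lfun _ _ _ _ _ (`|c| * \sum_(i < size J) `|J`_i|)).
  apply: filterS2 cvg_eta hY => w /(@mean_le1 _ (X ^~ w)) eta1 ->.
  by rewrite normrM ler_wpM2l// horner_norm_le1.
- have mJ : horner (c *: modified_jacobi al1 al0 n) \in @mfun _ _ R R.
    by rewrite inE; exact: measurable_poly.
  exists (mfun_Sub mJ); apply: filterS hY => w ->.
  by rewrite mfun_valP [RHS]hornerZ.
(* Depending only on the number of ones, [phi] is symmetric; the factor [c * K] reproduces [c] times
   the Jacobi polynomial. *)
pose phi (t : n.-tuple bool) := c * K * r (count_mem true t).
have phiE m : (m <= n)%N -> phi (ones_zeros n m) = c * K * r m.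
  by move=> mn; rewrite /phi count_ones_zeros.
exists phi; last first.
  apply: filterS hY => w ->.
  rewrite -(horner_bernstein_comb n (fun m => phi (ones_zeros n m))).
  by rewrite (bernstein_combZ phiE) JE !hornerZ mulrA.
apply/(XiP al1_gt0 al0_gt0 polyaX); split.
  move=> s a; rewrite /phi; congr (_ * _); congr r.
  by apply/seq.permP/tuple_permP; exists s.
apply/(@two_term_recurrence _ al1 al0 k (fun m => phi (ones_zeros n m)) al1_gt0).
move=> m mn; rewrite !phiE// /r big_ord0 expr0; ring.
Qed.
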